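(* Let $r\geq 3$ and $m,n>1$ be integers, let $K_{m,n}^{r}$ be the complete bipartite $r$-uniform hypergraph, and let $C_\tau$ denote the transversal coalition number. Then: (i) $C_\tau(K_{m,n}^{r})=r$ if $m+n=r$; (ii) $C_\tau(K_{m,n}^{r})=r+1$ if $m+n=r+1$; (iii) $C_\tau(K_{m,n}^{r})=r+1$ if $m+n>r+1$ and either $m=r-1$ or $n=r-1$.
   Context: A hypergraph $H=(U,\mathcal{E})$ consists of a finite vertex set $U$ and a family $\mathcal{E}$ of subsets of $U$ called (hyper)edges; it is $r$-uniform if every edge has exactly $r$ vertices. The complete bipartite $r$-uniform hypergraph $K^r_{m,n}$ has vertex set $U=U_1\cup U_2$ with $U_1\cap U_2=\emptyset$, $|U_1|=m$, $|U_2|=n$, and edge set $\mathcal{E}=\{e\subset U: |e|=r \text{ and } e\cap U_i\neq\emptyset \text{ for } i=1,2\}$ (where $e\subset U$ allows $e=U$). A transversal of $H$ is a set $T\subseteq U$ with $T\cap e\neq\emptyset$ for every $e\in\mathcal{E}$. Two disjoint sets $A,B\subseteq U$ form a transversal coalition if neither $A$ nor $B$ is a transversal of $H$ but $A\cup B$ is a transversal of $H$. A transversal coalition partition of $H$ is a partition $\varphi=\{P_1,\dots,P_k\}$ of $U$ into nonempty sets such that each $P_i$ either is a singleton that is a transversal of $H$, or is not a transversal of $H$ and forms a transversal coalition with some other (non-transversal) set $P_j\in\varphi$. The transversal coalition number $C_\tau(H)$ is the maximum $k$ for which $H$ has a transversal coalition partition with $k$ parts. *)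

(* Defs.v *)
From mathcomp Require Import all_boot.

Set Implicit Arguments.
Unset Strict Implicit.
Unset Printing Implicit Defensive.

(* The vertex set is the whole carrier type. *)
Record hypergraph := Hypergraph {
  vertex :> finType;
  edges : {set {set vertex}}
}.

(* [H] is a copy of K^r_(m,n), for some bipartition of its vertex set. *)
Definition is_complete_bipartite (r m n : nat) (H : hypergraph) : Prop :=
  exists U1 U2 : {set H},
    [/\ U1 :|: U2 = [set: H],
        U1 :&: U2 = set0,
        #|U1| = m,
        #|U2| = n
      & edges H =
          [set e : {set H} |
            [&& #|e| == r, e :&: U1 != set0 & e :&: U2 != set0]]].

Section TransversalCoalitions.

Variable H : hypergraph.

Definition transversal_of (A : {set H}) : bool :=
  [forall e in edges H, A :&: e != set0].

Definition transversal_coalition (A B : {set H}) : bool :=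
  [&& [disjoint A & B], ~~ transversal_of A, ~~ transversal_of B
    & transversal_of (A :|: B)].

Definition coalition_partition (P : {set {set H}}) : bool :=
  partition P [set: H] &&
  [forall A in P,
     ((#|A| == 1) && transversal_of A) ||
     (~~ transversal_of A &&
      [exists B in P, (B != A) && transversal_coalition A B])].

(* The value is 0 when there is no transversal coalition partition. *)
Definition coalition_number : nat :=
  \max_(P : {set {set H}} | coalition_partition P) #|P|.

End TransversalCoalitions.

(* Main.v *)
(* A set is a transversal of K^r_(m,n) iff it contains a whole side or its
   complement has fewer than r vertices. If m + n = r, every nonempty set is a
   transversal, and if m + n = r + 1, exactly the sets with at least two elements
   are; the partition into singletons is then optimal. If m = r - 1, a coalition
   partition with more than two parts contains a coalition A, B leaving fewer
   than r vertices uncovered, which bounds the number of parts by r + 1; for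
   v in U2, the set U2 - v and the singletons of U1 + v attain this bound. *)
Require Import Defs.
From mathcomp Require Import all_boot.

Set Implicit Arguments.
Unset Strict Implicit.
Unset Printing Implicit Defensive.

(** * Subsets of prescribed size and partitions of finite sets *)

(** Add to [A] a subset of [C :\: A] of size [k - #|A|]; a positive binomial coefficient counts
    these. This serves to extend a pair of vertices to an edge. *)
Lemma exists_subset_between (T : finType) (A C : {set T}) k :
  A \subset C -> #|A| <= k <= #|C| ->
  exists2 B : {set T}, A \subset B & (B \subset C) && (#|B| == k).
Proof.
move=> sAC /andP[leAk lekC].
have: 0 < 'C(#|C :\: A|, k - #|A|).
  by rewrite bin_gt0 cardsDS // leq_sub2r.
rewrite -cards_draws => /card_gt0P[B]; rewrite inE => /andP[sB /eqP cB].
have [sBC dAB] : B \subset C /\ [disjoint B & A].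
  by apply/andP; rewrite -subsetD.
exists (A :|: B); first exact: subsetUl.
rewrite subUset sAC sBC cardsU setIC disjoint_setI0 // cards0 subn0 cB.
by rewrite subnKC ?eqxx.
Qed.

Lemma partition_singletons (T : finType) (D : {set T}) :
  partition [set [set x] | x in D] D.
Proof.
apply/and3P; split.
- rewrite cover_imset; apply/eqP/setP=> x.
  apply/bigcupP/idP=> [[y Dy /set1P->] //|Dx].
  by exists x; rewrite ?set11.
- apply/trivIsetP=> _ _ /imsetP[x _ ->] /imsetP[y _ ->] neq.
  by rewrite disjoints1 inE; apply: contraNN neq => /eqP->.
- by apply/imsetP=> -[x _ /setP/(_ x)]; rewrite !inE eqxx.
Qed.

Lemma card_singletons (T : finType) (D : {set T}) :
  #|[set [set x] | x in D]| = #|D|.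
Proof. by rewrite card_imset //; apply: set1_inj. Qed.

Lemma leq_card_partition (T : finType) (P : {set {set T}}) (D : {set T}) :
  partition P D -> #|P| <= #|D|.
Proof.
move=> partP; rewrite (card_partition partP) -sum1_card.
by apply: leq_sum => A /(partition_neq0 partP); rewrite card_gt0.
Qed.

(** Every part other than [A] and [B] takes up at least one vertex outside their union. *)
Lemma leq_card_partition2 (T : finType) (P : {set {set T}}) (A B : {set T}) :
  partition P [set: T] -> A \in P -> B \in P -> B != A ->
  #|P| <= #|~: (A :|: B)|.+2.
Proof.
move=> partP PA PB neqBA; have PB' : B \in P :\ A by rewrite in_setD1 neqBA.
have /leq_card_partition := partitionD1 (partitionD1 partP PA) PB'.
by rewrite [[set: T] :\: _ :\: _]setDDl setTD (cardsD1 A P) PA (cardsD1 B (P :\ A)) PB'.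
Qed.

Lemma coalition_numberP (H : hypergraph) k :
  (exists2 P : {set {set H}}, coalition_partition P & #|P| = k) ->
  (forall P : {set {set H}}, coalition_partition P -> #|P| <= k) ->
  coalition_number H = k.
Proof.
move=> [P cP cardP] maxP; apply/eqP; rewrite eqn_leq; apply/andP; split.
  exact/bigmax_leqP.
by rewrite -cardP; apply: leq_bigmax_cond.
Qed.

Lemma coalition_number_singletons (H : hypergraph) :
  coalition_partition [set [set x] | x in [set: H]] ->
  coalition_number H = #|H|.
Proof.
move=> cP; apply: coalition_numberP.
  by exists [set [set x] | x in [set: H]]; rewrite // card_singletons cardsT.
by move=> P /andP[/leq_card_partition]; rewrite cardsT.
Qed.

(** * Transversals of the complete bipartite hypergraph *)

Section CompleteBipartite.

Variables (r : nat) (H : hypergraph) (U1 U2 : {set H}).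
Hypothesis r_gt2 : 2 < r.
Hypothesis U12T : U1 :|: U2 = [set: H].
Hypothesis dU12 : U1 :&: U2 = set0.
Hypothesis U1_gt1 : 1 < #|U1|.
Hypothesis U2_gt1 : 1 < #|U2|.
Hypothesis edgesH : edges H =
  [set e : {set H} | [&& #|e| == r, e :&: U1 != set0 & e :&: U2 != set0]].

Lemma card_vertices : #|H| = #|U1| + #|U2|.
Proof. by rewrite -cardsT -U12T cardsU dU12 cards0 subn0. Qed.

(** If [A] misses a vertex on each side and at least [r] vertices in all, two such missed vertices
    extend to an edge inside the complement of [A]. *)
Lemma transversal_ofE (A : {set H}) :
  transversal_of A = [|| U1 \subset A, U2 \subset A | #|~: A| < r].
Proof.
apply/idP/idP=> [/forall_inP trA|].
  apply: contraT; rewrite !negb_or -leqNgt.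
  case/and3P=> /subsetPn[x U1x nAx] /subsetPn[y U2y nAy] ler.
  have sxyA : [set x; y] \subset ~: A.
    by apply/subsetP=> z; rewrite !inE => /orP[]/eqP->.
  have c2 : #|[set x; y]| <= r <= #|~: A|.
    by rewrite ler andbT cards2; case: (x != y); rewrite // ltnW // ltnW.
  have [e /subsetP xye /andP[sAe cre]] := exists_subset_between sxyA c2.
  have /trA : e \in edges H.
    rewrite edgesH inE cre /=; apply/andP; split; apply/set0Pn.
      by exists x; rewrite inE U1x xye // !inE eqxx.
    by exists y; rewrite inE U2y xye // !inE eqxx orbT.
  by rewrite setIC setI_eq0 disjoints_subset sAe.
move=> trA; apply/forall_inP=> e; rewrite edgesH inE => /and3P[/eqP cre e1 e2].
(* The cases are taken in the order [U2 \subset A], small complement, [U1 \subset A]. An edge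
   disjoint from [A] would miss a side, or be [r] vertices inside the complement. *)
case/or3P: trA => [sA|sA|]; first 1 last.
- by apply: contraNneq e2 => Ae0; rewrite -subset0 -Ae0 setIC setSI.
- apply: contraTneq => Ae0; rewrite -leqNgt -cre subset_leq_card //.
  by rewrite -disjoints_subset -setI_eq0 setIC Ae0.
- by apply: contraNneq e1 => Ae0; rewrite -subset0 -Ae0 setIC setSI.
Qed.

(** Both sides have at least two vertices, so a singleton contains neither, and only the size of its
    complement matters. *)
Lemma transversal_set1 x : @transversal_of H [set x] = (#|H| <= r).
Proof.
have nsub (U : {set H}) : 1 < #|U| -> (U \subset [set x]) = false.
  by move=> U_gt1; apply: contraTF U_gt1 => /subset_leq_card; rewrite cards1 -leqNgt.
rewrite transversal_ofE !nsub //= cardsC1 prednK //.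
by rewrite card_vertices ltn_addr // ltnW.
Qed.

Lemma coalition_number_card_eq : #|H| = r -> coalition_number H = r.
Proof.
move=> cardH; rewrite -[RHS]cardH; apply: coalition_number_singletons.
rewrite /coalition_partition partition_singletons.
apply/forall_inP=> _ /imsetP[x _ ->].
by rewrite cards1 transversal_set1 cardH leqnn.
Qed.

Lemma coalition_number_card_succ : #|H| = r.+1 -> coalition_number H = r.+1.
Proof.
move=> cardH; rewrite -[RHS]cardH; apply: coalition_number_singletons.
rewrite /coalition_partition partition_singletons.
apply/forall_inP=> _ /imsetP[x _ ->].
have ntr y : ~~ @transversal_of H [set y] by rewrite transversal_set1 cardH ltnn.
rewrite ntr (negPf (ntr x)) andbF /=.
have [y nyx] : exists y, y \in [set~ x].
  by apply/card_gt0P; rewrite cardsC1 cardH ltnW // ltnW.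
rewrite !inE in nyx.
apply/exists_inP; exists [set y]; first exact: imset_f.
rewrite (inj_eq set1_inj) nyx /transversal_coalition !ntr disjoints1 inE.
rewrite eq_sym nyx transversal_ofE /=; apply/or3P/Or33.
(* The complement of a pair has [r.+1 - 2 = r.-1] vertices. *)
have := cardsC [set x; y].
by rewrite cards2 eq_sym nyx cardH add2n => -[/eq_leq].
Qed.

(** * The case of a side with one vertex fewer than an edge *)

Section SideOfSizePredr.

Hypothesis cardU1 : #|U1| = r.-1.

(** If [U2 \subset A], the complement of [A] lies in [U1], which has only [r.-1] vertices. *)
Lemma transversal_ofE_predr (A : {set H}) :
  transversal_of A = (U1 \subset A) || (#|~: A| < r).
Proof.
rewrite transversal_ofE; congr (_ || _); apply: orb_idl => sU2A.
have sAU1 : ~: A \subset U1.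
  apply/subsetP=> x; rewrite inE; apply: contraNT => nU1x.
  by apply: (subsetP sU2A); have := in_setT x; rewrite -U12T inE (negPf nU1x).
by rewrite -(ltn_predK r_gt2) ltnS -cardU1 subset_leq_card.
Qed.

Lemma leq_card_coalition_partition (P : {set {set H}}) :
  r < #|H| -> coalition_partition P -> #|P| <= r.+1.
Proof.
move=> ltrH /andP[partP /forall_inP cP].
(* No singleton is a transversal when [r < #|H|], so every part must have a partner. *)
have partner A : A \in P ->
    exists2 B, B \in P & (B != A) && transversal_coalition A B.
  move/cP=> /orP[/andP[/cards1P[x ->]]|/andP[_ /exists_inP//]].
  by rewrite transversal_set1 leqNgt ltrH.
(* The [r.-1] or fewer remaining vertices and the two parts give at most [r.+1] parts. *)
have bound A B : A \in P -> B \in P -> B != A -> #|~: (A :|: B)| < r ->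
    #|P| <= r.+1.
  by move=> PA PB neqBA ltr; apply: leq_trans (leq_card_partition2 _ PA PB neqBA) _.
have [->|/set0Pn[A PA]] := eqVneq P set0; first by rewrite cards0.
have [B PB /andP[neqBA /and4P[_ _ _]]] := partner A PA.
rewrite transversal_ofE_predr => /orP[sU1AB|]; last exact: bound.
have [sP|/subsetPn[C PC]] := boolP (P \subset [set A; B]).
  apply: leq_trans (subset_leq_card sP) _.
  by rewrite cards2 eq_sym neqBA ltnW // ltnW.
rewrite !inE negb_or => /andP[neqCA neqCB].
have [D PD /andP[neqDC /and4P[_ _ ntrD]]] := partner C PC.
rewrite transversal_ofE_predr => /orP[sU1CD|]; last exact: bound.
(* C misses U1, which A and B already cover, so D alone contains U1. *)
case/negP: ntrD; rewrite transversal_ofE_predr; apply/orP; left.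
apply/subsetP=> x U1x; have := subsetP sU1CD x U1x; rewrite inE.
case/orP=> // Cx; have /trivIsetP tiP := partition_trivIset partP.
have := subsetP sU1AB x U1x; rewrite inE => /orP[Ax|Bx].
  by have := disjointFr (tiP _ _ PC PA neqCA) Cx; rewrite Ax.
by have := disjointFr (tiP _ _ PC PB neqCB) Cx; rewrite Bx.
Qed.

Lemma coalition_partition_exists :
  r < #|H| -> exists2 P : {set {set H}}, coalition_partition P & #|P| = r.+1.
Proof.
move=> ltrH; have /card_gt0P[v U2v] : 0 < #|U2| by apply: ltnW.
have notU1 x : x \in U2 -> x \notin U1.
  by move=> U2x; apply/negP=> U1x; have := in_set0 x; rewrite -dU12 inE U1x U2x.
have r_gt0 : 0 < r by rewrite ltnW // ltnW.
pose A := U2 :\ v; pose D := v |: U1.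
have defD : D = ~: A.
  apply/setP=> x; rewrite !inE negb_and negbK; case: eqVneq => //= _.
  have [/notU1/negPf//|nU2x] := boolP (x \in U2).
  by have := in_setT x; rewrite -U12T inE (negPf nU2x) orbF.
have cardD : #|D| = r by rewrite cardsU1 notU1 // cardU1 add1n (ltn_predK r_gt2).
have neA : A != set0.
  by rewrite -card_gt0; move: U2_gt1; rewrite (cardsD1 v) U2v.
have dAD : [disjoint A & D] by rewrite defD -setI_eq0 setICr.
have ntrA : ~~ transversal_of A.
  rewrite transversal_ofE_predr -defD cardD ltnn orbF.
  have /card_gt0P[u U1u] : 0 < #|U1| by apply: ltnW.
  apply/subsetPn; exists u => //; rewrite !inE negb_and orbC.
  by rewrite (contraL (@notU1 u)).
have ntr1 x : ~~ @transversal_of H [set x] by rewrite transversal_set1 -ltnNge.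
have coalA x : x \in D -> (A != [set x]) && transversal_coalition A [set x].
  move=> Dx; have nAx : x \notin A by rewrite defD inE in Dx.
  apply/andP; split; first by apply: contraNneq nAx => ->; rewrite inE.
  rewrite /transversal_coalition disjoint_sym disjoints1 nAx ntrA ntr1 /=.
  (* The complement of [A :|: [set x]] is [D] without [x], of size [r.-1]. *)
  rewrite transversal_ofE_predr setCU -defD -setDE.
  by rewrite -[in ltnRHS]cardD (cardsD1 x D) Dx ltnSn orbT.
have partP : partition (A |: [set [set x] | x in D]) [set: H].
  have -> : [set: H] = A :|: D by rewrite defD setUCr.
  by apply: partitionU1; rewrite ?partition_singletons.
exists (A |: [set [set x] | x in D]); last first.
  (* [A] may itself be a singleton, but it differs from those counted in [D]. *)
  rewrite cardsU1 card_singletons cardD (introN imsetP) //.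
  by case=> x /coalA/andP[/eqP].
apply/andP; split=> //; apply/forall_inP=> B /setU1P[->|/imsetP[x Dx ->]].
  apply/orP; right; rewrite ntrA; apply/exists_inP; exists [set v].
    by rewrite inE imset_f ?orbT // setU11.
  by rewrite eq_sym coalA ?setU11.
apply/orP; right; rewrite ntr1; apply/exists_inP; exists A; first exact: setU11.
have /andP[-> /and4P[dAx _ _ trAx]] := coalA x Dx.
by rewrite /transversal_coalition disjoint_sym dAx ntrA ntr1 setUC.
Qed.

Lemma coalition_number_predr : r < #|H| -> coalition_number H = r.+1.
Proof.
move=> ltrH; apply: coalition_numberP; first exact: coalition_partition_exists.
by move=> P; apply: leq_card_coalition_partition.
Qed.

End SideOfSizePredr.

End CompleteBipartite.

Theorem theorem4 (r m n : nat) (H : hypergraph) :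
  3 <= r -> 1 < m -> 1 < n ->
  is_complete_bipartite r m n H ->
  [/\ (m + n = r -> coalition_number H = r),
      (m + n = r.+1 -> coalition_number H = r.+1)
    & (r.+1 < m + n -> m = r.-1 \/ n = r.-1 -> coalition_number H = r.+1)].
Proof.
move=> r_gt2 m_gt1 n_gt1 [U1 [U2 [U12T dU12 cU1 cU2 edgesH]]].
have U1_gt1 : 1 < #|U1| by rewrite cU1.
have U2_gt1 : 1 < #|U2| by rewrite cU2.
rewrite -cU1 -cU2 -(card_vertices U12T dU12); split.
- exact: (coalition_number_card_eq r_gt2 U12T dU12 U1_gt1 U2_gt1 edgesH).
- exact: (coalition_number_card_succ r_gt2 U12T dU12 U1_gt1 U2_gt1 edgesH).
- move=> /ltnW ltrH [cU1r|cU2r].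
    exact: (coalition_number_predr r_gt2 U12T dU12 U1_gt1 U2_gt1 edgesH).
  (* The two sides play symmetric roles, so the previous case applies with them exchanged. *)
  have U21T : U2 :|: U1 = [set: H] by rewrite setUC.
  have dU21 : U2 :&: U1 = set0 by rewrite setIC.
  have edgesH' : edges H = [set e : {set H} |
      [&& #|e| == r, e :&: U2 != set0 & e :&: U1 != set0]].
    by rewrite edgesH; apply/setP=> e; rewrite !inE [X in _ && X]andbC.
  exact: (coalition_number_predr r_gt2 U21T dU21 U2_gt1 U1_gt1 edgesH').
Qed.
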